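(* There exists a computably enumerable set which is simultaneously $Q$-complete and $bwtt$-complete but not $c$-complete. Likewise, there exists a computably enumerable set which is simultaneously $Q$-complete and $btt$-complete but not $c$-complete.
   Context: $\omega$ is the set of natural numbers. $D_u$ denotes the finite set with canonical index $u$, and $W_e$ denotes the $e$-th computably enumerable (c.e.) set in a standard numbering; $\varphi_z^Y$ is the $z$-th partial function computable with oracle $Y$; $\chi_X$ is the characteristic function of $X$. For sets $X, Y \subseteq \omega$: - $X \le_c Y$ if there is a (total) computable function $f$ such that for all $x$: $x \in X \iff D_{f(x)} \subseteq Y$. - $X \le_Q Y$ if there is a computable function $f$ such that for all $x$: $x \in X \iff W_{f(x)} \subseteq Y$. - $X \le_{wtt} Y$ (weak truth-table reducibility) if there is $z$ with $\chi_X = \varphi_z^Y$ and there is a computable function $f$ such that for every $x$ the finite set $D_{f(x)}$ consists exactly of the numbers $y$ queried during the computation $\varphi_z^Y(x)$, i.e. those numbers for which the oracle is asked to determine the value $Y(y)$. If, in addition, there exists $n$ such that $|D_{f(x)}| \le n$ for all $x$, then $X \le_{bwtt} Y$. - $X \le_{btt} Y$ (bounded truth-table reducibility, in the standard sense) if there are $n \in \omega$ and a computable procedure which, on input $x$, outputs a finite set $F_x$ with $|F_x| \le n$ and a truth table (Boolean function) on the values of $\chi_Y$ on $F_x$ such that $x \in X$ if and only if the truth table is satisfied by $Y$. For a reducibility $r$, a c.e. set $A$ is $r$-complete if $B \le_r A$ for every c.e. set $B$. *)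

(* Defs.v *)
From Stdlib Require Import Arith Lia List Cantor Classical ClassicalEpsilon.
Import ListNotations.

(* Sets of natural numbers are predicates [nat -> Prop]. *)

Definition chi (X : nat -> Prop) (x : nat) : nat :=
  if excluded_middle_informative (X x) then 1 else 0.

(* Canonical index: u is the sum of 2 ^ x for x in D u, so x is in D u iff the
   binary digit of u of weight 2 ^ x is 1 (such an x is smaller than u).  The
   list has no repetition, so its length is the cardinality of the set. *)
Definition D (u : nat) : list nat := filter (Nat.testbit u) (seq 0 u).

Lemma in_D (u x : nat) : In x (D u) <-> Nat.testbit u x = true.
Proof.
  unfold D. rewrite filter_In, in_seq. split; [tauto|].
  intros H. split; [|exact H]. split; [lia|]. simpl.
  destruct (Nat.lt_ge_cases x u) as [Hlt|Hge]; [exact Hlt|exfalso].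
  assert (Hp : u < 2 ^ x)
    by (apply Nat.le_lt_trans with x; [exact Hge|apply Nat.pow_gt_lin_r; lia]).
  rewrite Nat.testbit_odd, Nat.shiftr_div_pow2, Nat.div_small in H by exact Hp.
  discriminate.
Qed.

Lemma NoDup_D (u : nat) : NoDup (D u).
Proof. apply NoDup_filter, seq_NoDup. Qed.

(* Programs for the unary oracle partial recursive functions; several arguments
   are packed into one by the Cantor pairing of the standard library. *)
Inductive code : Type :=
  | Zero | Succ | Left | Right | Oracle
  | Pair (f g : code)
  | Comp (f g : code)
  | Prec (f g : code)
  | Mu (f : code).

(* [eval Y c x v q]: with oracle Y, the program c halts on input x with output
   v, and q lists, in order, the numbers about which the oracle is asked.
   [Prec] is primitive recursion on the second component of the input; [Mu] is
   unbounded search starting at the second component: on <a,n> it returns the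
   least m >= n with f <a,m> = 0, provided f converges on <a,n>, ..., <a,m>. *)
Inductive eval (Y : nat -> Prop) : code -> nat -> nat -> list nat -> Prop :=
  | eval_Zero x : eval Y Zero x 0 []
  | eval_Succ x : eval Y Succ x (S x) []
  | eval_Left x : eval Y Left x (fst (Cantor.of_nat x)) []
  | eval_Right x : eval Y Right x (snd (Cantor.of_nat x)) []
  | eval_Oracle x : eval Y Oracle x (chi Y x) [x]
  | eval_Pair f g x v w p q :
      eval Y f x v p -> eval Y g x w q ->
      eval Y (Pair f g) x (Cantor.to_nat (v, w)) (p ++ q)
  | eval_Comp f g x v w p q :
      eval Y g x v p -> eval Y f v w q ->
      eval Y (Comp f g) x w (p ++ q)
  | eval_Prec_0 f g a v q :
      eval Y f a v q ->
      eval Y (Prec f g) (Cantor.to_nat (a, 0)) v q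
  | eval_Prec_S f g a n v w p q :
      eval Y (Prec f g) (Cantor.to_nat (a, n)) v p ->
      eval Y g (Cantor.to_nat (a, Cantor.to_nat (n, v))) w q ->
      eval Y (Prec f g) (Cantor.to_nat (a, S n)) w (p ++ q)
  | eval_Mu_stop f a n q :
      eval Y f (Cantor.to_nat (a, n)) 0 q ->
      eval Y (Mu f) (Cantor.to_nat (a, n)) n q
  | eval_Mu_next f a n k v p q :
      eval Y f (Cantor.to_nat (a, n)) (S k) p ->
      eval Y (Mu f) (Cantor.to_nat (a, S n)) v q ->
      eval Y (Mu f) (Cantor.to_nat (a, n)) v (p ++ q).

Fixpoint encode (c : code) : nat :=
  match c with
  | Zero => Cantor.to_nat (0, 0)
  | Succ => Cantor.to_nat (1, 0)
  | Left => Cantor.to_nat (2, 0)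
  | Right => Cantor.to_nat (3, 0)
  | Oracle => Cantor.to_nat (4, 0)
  | Pair f g => Cantor.to_nat (5, Cantor.to_nat (encode f, encode g))
  | Comp f g => Cantor.to_nat (6, Cantor.to_nat (encode f, encode g))
  | Prec f g => Cantor.to_nat (7, Cantor.to_nat (encode f, encode g))
  | Mu f => Cantor.to_nat (8, encode f)
  end.

(* phi_z^Y (x) = v, with list of queries q.  If z is not the number of a
   program, then phi_z^Y is the nowhere defined function. *)
Definition Phi (z : nat) (Y : nat -> Prop) (x v : nat) (q : list nat) : Prop :=
  exists c, encode c = z /\ eval Y c x v q.

(* Computability without an oracle is computability with the empty oracle. *)
Definition phi (e x v : nat) : Prop :=
  exists q, Phi e (fun _ => False) x v q.

Definition computable (f : nat -> nat) : Prop :=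
  exists e, forall x, phi e x (f x).

Definition W (e x : nat) : Prop := exists v, phi e x v.

Definition ce (A : nat -> Prop) : Prop :=
  exists e, forall x, A x <-> W e x.

Definition le_c (X Y : nat -> Prop) : Prop :=
  exists f, computable f /\
    forall x, X x <-> (forall y, In y (D (f x)) -> Y y).

Definition le_Q (X Y : nat -> Prop) : Prop :=
  exists f, computable f /\
    forall x, X x <-> (forall y, W (f x) y -> Y y).

Definition wtt_via (z : nat) (f : nat -> nat) (X Y : nat -> Prop) : Prop :=
  computable f /\
  forall x, exists q,
    Phi z Y x (chi X x) q /\ (forall y, In y (D (f x)) <-> In y q).

Definition le_wtt (X Y : nat -> Prop) : Prop :=
  exists z f, wtt_via z f X Y.

Definition le_bwtt (X Y : nat -> Prop) : Prop :=
  exists z f, wtt_via z f X Y /\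
    exists n, forall x, length (D (f x)) <= n.

(* A truth table on a finite set F is given by the set of its satisfying rows,
   a row being the subset of F on which the arguments are true; u is the
   canonical index of F, t that of the set of canonical indices of the rows. *)
Definition tt_satisfied (u t : nat) (Y : nat -> Prop) : Prop :=
  exists r, In r (D t) /\ (forall y, In y (D r) <-> In y (D u) /\ Y y).

Definition le_btt (X Y : nat -> Prop) : Prop :=
  exists n f t, computable f /\ computable t /\
    forall x, length (D (f x)) <= n /\ (X x <-> tt_satisfied (f x) (t x) Y).

Definition complete (le : (nat -> Prop) -> (nat -> Prop) -> Prop)
    (A : nat -> Prop) : Prop :=
  ce A /\ forall B, ce B -> le B A.

Lemma encode_inj (c d : code) : encode c = encode d -> c = d.
Proof.
  revert d; induction c; intros []; cbn [encode]; intros H;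
    apply Cantor.to_nat_inj, pair_equal_spec in H; destruct H as [T H];
    try discriminate T; try reflexivity.
  4: f_equal; auto.
  all: apply Cantor.to_nat_inj, pair_equal_spec in H; destruct H;
    f_equal; auto.
Qed.

Lemma eval_functional (Y : nat -> Prop) (c : code) (x v w : nat)
    (p q : list nat) :
  eval Y c x v p -> eval Y c x w q -> v = w /\ p = q.
Proof.
  intros H; revert w q; induction H; intros w' q' H';
    match type of H' with eval _ _ ?x _ _ => remember x as z eqn:E end;
    inversion H'; subst;
    repeat match goal with
    | E : Cantor.to_nat _ = Cantor.to_nat _ |- _ =>
        apply Cantor.to_nat_inj, pair_equal_spec in E;
        let A := fresh in let B := fresh in
        destruct E as [A B]; try discriminate B; try injection B as B; subst
    end; auto;
    repeat match goal with
    | IH : forall w q, eval Y ?f ?x w q -> _, E : eval Y ?f ?x _ _ |- _ =>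
        let A := fresh in let B := fresh in
        destruct (IH _ _ E) as [A B]; clear E; try discriminate A;
        try (injection A; clear A; intros); subst
    end; auto.
Qed.

(* Main.v *)
Require Import Defs.

(* One set A, built by a finite injury argument together with a c.e. set B, serves
   for both halves.  Let K be a universal c.e. set.  Each x owns a block of elements
   (x,k).  If x is in K, exactly one of (x,0), (x,1) and all (x,k) with k >= 2 are
   put into A; otherwise neither of the former and only finitely many of the latter.
   The first two elements make A btt- and bwtt-complete, the others Q-complete.

   Against a reduction e of B to A by finite sets F(e,0), F(e,1), ..., one looks at
   the first i such that not both (e,i) is in B and F(e,i) is a subset of A.  Once
   F(e,i) is known, its elements (x,k) with k >= 2 and x >= e are dumped into A; if
   that does not make F(e,i) a subset of A, then (e,i) is put into B and F(e,i) is
   guarded with priority e.  When x enters K, the one of (x,0), (x,1) that is not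
   guarded with higher priority is enumerated.

   Each e acts finitely often.  By induction only finitely many elements are guarded
   by, or dumped into blocks below e by, requirements of higher priority.  Past the
   stage where A is settled on these and their partners, suppose F(e,i) is guarded by
   e and later becomes a subset of A.  Some (x,k) in it with k < 2 enters while
   guarded by e, so its partner is guarded with priority at most e, hence e itself;
   then both lie in F(e,i), but only one of them is ever enumerated.  So e stops with
   a witness on which the reduction fails. *)
From Stdlib Require Import Arith Lia List Bool Cantor Classical.
Import ListNotations.

(** * Pairing of natural numbers *)

Definition pack (x y : nat) : nat := Cantor.to_nat (x, y).
Definition pi1 (n : nat) : nat := fst (Cantor.of_nat n).
Definition pi2 (n : nat) : nat := snd (Cantor.of_nat n).

Lemma pi1_pack x y : pi1 (pack x y) = x.
Proof. unfold pi1, pack. now rewrite Cantor.cancel_of_to. Qed.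

Lemma pi2_pack x y : pi2 (pack x y) = y.
Proof. unfold pi2, pack. now rewrite Cantor.cancel_of_to. Qed.

Lemma pack_pi n : pack (pi1 n) (pi2 n) = n.
Proof.
  unfold pi1, pi2, pack. now rewrite <- surjective_pairing, Cantor.cancel_to_of.
Qed.

Lemma pack_ge x y : x <= pack x y /\ y <= pack x y.
Proof. pose proof (Cantor.to_nat_non_decreasing x y). unfold pack. lia. Qed.

Arguments pack : simpl never.
Arguments pi1 : simpl never.
Arguments pi2 : simpl never.

Lemma eval_Left' Y x : eval Y Left x (pi1 x) [].
Proof. apply eval_Left. Qed.

Lemma eval_Right' Y x : eval Y Right x (pi2 x) [].
Proof. apply eval_Right. Qed.

Lemma eval_Pair' Y f g x v w p q :
  eval Y f x v p -> eval Y g x w q -> eval Y (Pair f g) x (pack v w) (p ++ q).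
Proof. apply eval_Pair. Qed.

(** * Recursive functions *)

(** One program must serve all oracles and ask nothing, so that it can be used inside the [bwtt]
    reduction without adding to its list of queries. *)
Definition rec (f : nat -> nat) : Prop :=
  exists c, forall Y x, eval Y c x (f x) [].

Definition dec (b : nat -> bool) : Prop := rec (fun x => Nat.b2n (b x)).

Lemma rec_computable f : rec f -> computable f.
Proof. intros [c H]. exists (encode c). intros x. exists [], c. auto. Qed.

Lemma rec_ext f g : (forall x, f x = g x) -> rec f -> rec g.
Proof. intros E [c H]. exists c. intros Y x. rewrite <- E. auto. Qed.

Lemma rec_comp f g : rec f -> rec g -> rec (fun x => f (g x)).
Proof.
  intros [c H] [d G]. exists (Comp c d). intros Y x.
  apply (eval_Comp Y c d x (g x) (f (g x)) [] []); auto.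
Qed.

Lemma dec_comp b g : dec b -> rec g -> dec (fun x => b (g x)).
Proof. intros H G. exact (rec_comp _ _ H G). Qed.

Lemma rec_id : rec (fun x => x).
Proof.
  exists (Pair Left Right). intros Y x. rewrite <- (pack_pi x) at 2.
  exact (eval_Pair' _ _ _ _ _ _ [] [] (eval_Left' _ _) (eval_Right' _ _)).
Qed.

Lemma rec_S f : rec f -> rec (fun x => S (f x)).
Proof. apply (rec_comp S). exists Succ. intros. apply eval_Succ. Qed.

Lemma rec_const n : rec (fun _ => n).
Proof.
  induction n as [|n IH]; [exists Zero; intros; apply eval_Zero|].
  exact (rec_S _ IH).
Qed.

Lemma rec_pi1 f : rec f -> rec (fun x => pi1 (f x)).
Proof. apply (rec_comp pi1). exists Left. intros. apply eval_Left'. Qed.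

Lemma rec_pi2 f : rec f -> rec (fun x => pi2 (f x)).
Proof. apply (rec_comp pi2). exists Right. intros. apply eval_Right'. Qed.

Lemma rec_pack f g : rec f -> rec g -> rec (fun x => pack (f x) (g x)).
Proof.
  intros [c H] [d G]. exists (Pair c d). intros Y x.
  exact (eval_Pair' _ _ _ _ _ _ [] [] (H _ _) (G _ _)).
Qed.

(** [Prec] recurses on the second component of its input, so the parameter [x] is carried along in
    the first; the recursion is then applied to [pack x (n x)]. *)
Lemma rec_nat_rect z s n :
  rec z -> rec (fun p => s (pi1 p) (pi1 (pi2 p)) (pi2 (pi2 p))) -> rec n ->
  rec (fun x => nat_rect (fun _ => nat) (z x) (fun k r => s x k r) (n x)).
Proof.
  intros [cz Hz] [cs Hs] Hn.
  assert (H : rec (fun p => nat_rect (fun _ => nat) (z (pi1 p))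
                    (fun k r => s (pi1 p) k r) (pi2 p))).
  { exists (Prec cz cs). intros Y p. rewrite <- (pack_pi p) at 1.
    generalize (pi1 p), (pi2 p). clear p. intros a n'.
    induction n' as [|k IH]; simpl.
    - apply eval_Prec_0, Hz.
    - apply (eval_Prec_S Y cz cs a k _ _ [] [] IH).
      specialize (Hs Y (pack a (pack k (nat_rect (fun _ => nat) (z a)
        (fun k r => s a k r) k)))).
      rewrite pi1_pack, !pi2_pack, pi1_pack in Hs. exact Hs. }
  apply (rec_ext (fun x => nat_rect (fun _ => nat) (z (pi1 (pack x (n x))))
    (fun k r => s (pi1 (pack x (n x))) k r) (pi2 (pack x (n x))))).
  - intros x. now rewrite pi1_pack, pi2_pack.
  - exact (rec_comp _ _ H (rec_pack _ _ rec_id Hn)).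
Qed.

Create HintDb rec.
Hint Constants Opaque : rec.
Hint Resolve rec_id rec_S rec_const rec_pi1 rec_pi2 rec_pack rec_nat_rect : rec.
Hint Extern 1 (rec (fun x => ?f (@?g x))) =>
  match goal with H : rec f |- _ => apply (rec_comp f g H) end : rec.
Hint Extern 1 (dec (fun x => ?f (@?g x))) =>
  match goal with H : dec f |- _ => apply (dec_comp f g H) end : rec.

Ltac solve_rec := auto 40 with rec nocore.

Lemma rec_if b f g :
  dec b -> rec f -> rec g -> rec (fun x => if b x then f x else g x).
Proof.
  intros Hb Hf Hg.
  apply (rec_ext (fun x => nat_rect (fun _ => nat) (g x) (fun _ _ => f x)
    (Nat.b2n (b x)))).
  - intros x. now destruct (b x).
  - unfold dec in Hb. solve_rec.
Qed.

Lemma rec_pred f : rec f -> rec (fun x => pred (f x)).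
Proof.
  intros Hf. apply (rec_ext (fun x => nat_rect (fun _ => nat) 0
    (fun k _ => k) (f x))).
  - intros x. now destruct (f x).
  - solve_rec.
Qed.

Lemma rec_add f g : rec f -> rec g -> rec (fun x => f x + g x).
Proof.
  intros Hf Hg. apply (rec_ext (fun x => nat_rect (fun _ => nat) (g x)
    (fun _ r => S r) (f x))).
  - intros x. induction (f x); simpl; congruence.
  - solve_rec.
Qed.
Hint Resolve rec_if rec_pred rec_add : rec.

Lemma rec_sub f g : rec f -> rec g -> rec (fun x => f x - g x).
Proof.
  intros Hf Hg. apply (rec_ext (fun x => nat_rect (fun _ => nat) (f x)
    (fun _ r => pred r) (g x))).
  - intros x. induction (g x); simpl; lia.
  - solve_rec.
Qed.

Lemma rec_pow2 f : rec f -> rec (fun x => 2 ^ f x).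
Proof.
  intros Hf. apply (rec_ext (fun x => nat_rect (fun _ => nat) 1
    (fun _ r => r + r) (f x))).
  - intros x. induction (f x); simpl; lia.
  - solve_rec.
Qed.
Hint Resolve rec_sub rec_pow2 : rec.

Lemma dec_eqb f g : rec f -> rec g -> dec (fun x => f x =? g x).
Proof.
  intros Hf Hg. apply (rec_ext (fun x => 1 - ((f x - g x) + (g x - f x)))).
  - intros x. destruct (Nat.eqb_spec (f x) (g x)); simpl Nat.b2n; lia.
  - solve_rec.
Qed.

Lemma dec_leb f g : rec f -> rec g -> dec (fun x => f x <=? g x).
Proof.
  intros Hf Hg. apply (rec_ext (fun x => 1 - (f x - g x))).
  - intros x. destruct (Nat.leb_spec (f x) (g x)); simpl Nat.b2n; lia.
  - solve_rec.
Qed.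

Lemma dec_negb b : dec b -> dec (fun x => negb (b x)).
Proof.
  intros H. apply (rec_ext (fun x => if b x then 0 else 1)).
  - intros x. now destruct (b x).
  - solve_rec.
Qed.

Lemma dec_andb a b : dec a -> dec b -> dec (fun x => a x && b x).
Proof.
  intros Ha Hb. apply (rec_ext (fun x => if a x then if b x then 1 else 0 else 0)).
  - intros x. now destruct (a x), (b x).
  - solve_rec.
Qed.

Lemma dec_orb a b : dec a -> dec b -> dec (fun x => a x || b x).
Proof.
  intros Ha Hb. apply (rec_ext (fun x => if a x then 1 else if b x then 1 else 0)).
  - intros x. now destruct (a x), (b x).
  - solve_rec.
Qed.
Hint Resolve dec_eqb dec_leb dec_negb dec_andb dec_orb : rec.

Lemma dec_odd f : rec f -> dec (fun x => Nat.odd (f x)).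
Proof.
  intros Hf. apply (rec_ext (fun x => nat_rect (fun _ => nat) 0
    (fun _ r => 1 - r) (f x))).
  - intros x. induction (f x) as [|n IH]; [reflexivity|].
    rewrite Nat.odd_succ, <- Nat.negb_odd. cbn [nat_rect]. rewrite IH.
    now destruct (Nat.odd n).
  - solve_rec.
Qed.
Hint Resolve dec_odd : rec.

Lemma rec_div2 f : rec f -> rec (fun x => Nat.div2 (f x)).
Proof.
  intros Hf. apply (rec_ext (fun x => nat_rect (fun _ => nat) 0
    (fun k r => if Nat.odd k then S r else r) (f x))).
  - intros x. induction (f x) as [|n IH]; [reflexivity|].
    cbn [nat_rect]. rewrite IH. destruct (Nat.odd n) eqn:E.
    + apply Nat.odd_spec in E. rewrite <- Nat.Odd_div2; auto.
    + rewrite <- Nat.negb_even in E. apply negb_false_iff, Nat.even_spec in E.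
      now rewrite <- Nat.Even_div2.
  - solve_rec.
Qed.
Hint Resolve rec_div2 : rec.

Lemma dec_testbit f g : rec f -> rec g -> dec (fun x => Nat.testbit (f x) (g x)).
Proof.
  intros Hf Hg. apply (rec_ext (fun x => Nat.b2n (Nat.odd
    (nat_rect (fun _ => nat) (f x) (fun _ r => Nat.div2 r) (g x))))).
  (* [Nat.shiftr] is by definition an iteration of [Nat.div2]. *)
  - intros x. rewrite Nat.testbit_odd. reflexivity.
  - change (dec (fun x => Nat.odd
      (nat_rect (fun _ => nat) (f x) (fun _ r => Nat.div2 r) (g x)))). solve_rec.
Qed.
Hint Resolve dec_testbit : rec.

(** If the bit is absent, adding the power of 2 causes no carry. This makes the enumeration of an
    element into a bit set recursive. *)
Lemma setbit_add u y :
  Nat.setbit u y = if Nat.testbit u y then u else u + 2 ^ y.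
Proof.
  apply Nat.bits_inj. intros z. rewrite Nat.setbit_eqb.
  destruct (Nat.testbit u y) eqn:E.
  - destruct (Nat.eqb_spec y z) as [<-|]; auto.
  - assert (H : Nat.land u (2 ^ y) = 0).
    { apply Nat.bits_inj. intros t. rewrite Nat.land_spec, Nat.bits_0, Nat.pow2_bits_eqb.
      destruct (Nat.eqb_spec y t) as [<-|]; [now rewrite E|apply andb_false_r]. }
    rewrite Nat.add_nocarry_lxor, Nat.lxor_lor, Nat.lor_spec, Nat.pow2_bits_eqb by exact H.
    apply orb_comm.
Qed.

Lemma rec_setbit f g : rec f -> rec g -> rec (fun x => Nat.setbit (f x) (g x)).
Proof.
  intros Hf Hg. eapply rec_ext; [intros x; symmetry; apply setbit_add|].
  solve_rec.
Qed.
Hint Resolve rec_setbit : rec.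

Lemma testbit_lt u y : Nat.testbit u y = true -> y < u.
Proof.
  intros H. apply in_D in H. apply filter_In in H. destruct H as [H _].
  apply in_seq in H. lia.
Qed.

(* The value is [n] if there is no witness below [n]. *)
Definition least (P : nat -> bool) (n : nat) : nat :=
  nat_rect (fun _ => nat) 0
    (fun k r => if S r <=? k then r else if P k then k else S k) n.

Lemma least_spec P n :
  least P n <= n /\ (forall i, i < least P n -> P i = false) /\
  (least P n < n -> P (least P n) = true).
Proof.
  induction n as [|n (IH1 & IH2 & IH3)]; [simpl; repeat split; lia|].
  change (least P (S n)) with
    (if S (least P n) <=? n then least P n else if P n then n else S n).
  destruct (Nat.leb_spec (S (least P n)) n) as [L|L].
  - repeat split; auto; lia.
  - assert (E : least P n = n) by lia. rewrite E in *.
    destruct (P n) eqn:Pn; repeat split; auto; try lia.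
    intros i Hi. assert (Hi' : i < n \/ i = n) by lia.
    destruct Hi' as [Hi'| ->]; auto.
Qed.

Lemma least_le P n i : P i = true -> least P n <= i.
Proof.
  intros H. destruct (least_spec P n) as (_ & Q & _).
  destruct (Nat.le_gt_cases (least P n) i) as [|L]; auto.
  rewrite (Q i L) in H. discriminate.
Qed.

Lemma rec_least P n :
  dec (fun p => P (pi1 p) (pi2 p)) -> rec n ->
  rec (fun x => least (fun i => P x i) (n x)).
Proof.
  intros HP Hn. unfold least. apply rec_nat_rect; [solve_rec| |solve_rec].
  assert (dec (fun p => P (pi1 p) (pi1 (pi2 p)))).
  { eapply rec_ext;
      [|exact (dec_comp _ (fun p => pack (pi1 p) (pi1 (pi2 p))) HP ltac:(solve_rec))].
    intros p. cbv beta. now rewrite pi1_pack, pi2_pack. }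
  solve_rec.
Qed.
Hint Resolve rec_least : rec.

Definition allb (P : nat -> bool) (n : nat) : bool :=
  least (fun i => negb (P i)) n =? n.

Lemma allb_spec P n : allb P n = true <-> forall i, i < n -> P i = true.
Proof.
  unfold allb. destruct (least_spec (fun i => negb (P i)) n) as (H1 & H2 & H3).
  rewrite Nat.eqb_eq. split.
  - intros E i Hi. apply negb_false_iff, H2. lia.
  - intros H. destruct (Nat.le_gt_cases n (least (fun i => negb (P i)) n)); [lia|].
    specialize (H3 H0). rewrite H in H3 by lia. discriminate.
Qed.

Lemma dec_allb P n :
  dec (fun p => P (pi1 p) (pi2 p)) -> rec n ->
  dec (fun x => allb (fun i => P x i) (n x)).
Proof. intros HP Hn. unfold allb. solve_rec. Qed.
Hint Resolve dec_allb : rec.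

(** * Semidecidable sets and the s-m-n theorem *)

Lemma semidecidable P :
  dec (fun p => P (pi1 p) (pi2 p)) ->
  exists c, forall x, (exists t, P x t = true) <-> W (encode c) x.
Proof.
  intros H. destruct (dec_negb _ H) as [c Hc].
  (* [Mu] stops at the value 0, so [c] computes the negation of [P]; the search starts at
     [pack x 0], and [Pair Left Right] serves as the identity. *)
  pose (s := Comp (Mu c) (Pair (Pair Left Right) Zero)).
  assert (Hv : forall x t, eval (fun _ => False) c (pack x t)
                 (Nat.b2n (negb (P x t))) []).
  { intros x t. specialize (Hc (fun _ => False) (pack x t)).
    rewrite pi1_pack, pi2_pack in Hc. exact Hc. }
  exists s. intros x. split.
  - intros [t Ht].
    (* Induction on the distance [k] to a known witness; the search may stop before reaching it. *)
    assert (E : forall k n, P x (k + n) = true ->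
              exists v, eval (fun _ => False) (Mu c) (pack x n) v []).
    { induction k as [|k IH]; intros n Hn.
      - exists n. apply eval_Mu_stop. specialize (Hv x n). simpl in Hn.
        rewrite Hn in Hv. exact Hv.
      - destruct (P x n) eqn:En.
        + exists n. apply eval_Mu_stop. specialize (Hv x n).
          rewrite En in Hv. exact Hv.
        + destruct (IH (S n)) as [v Hv']; [rewrite Nat.add_succ_r; exact Hn|].
          exists v. specialize (Hv x n). rewrite En in Hv.
          exact (eval_Mu_next _ _ _ _ _ _ [] [] Hv Hv'). }
    destruct (E t 0) as [v Hv']; [rewrite Nat.add_0_r; auto|].
    exists v, [], s. split; auto. unfold s.
    refine (eval_Comp _ _ _ _ _ _ [] [] _ Hv').
    refine (eval_Pair' _ _ _ _ _ _ [] [] _ (eval_Zero _ _)).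
    rewrite <- (pack_pi x) at 2.
    exact (eval_Pair' _ _ _ _ _ _ [] [] (eval_Left' _ _) (eval_Right' _ _)).
  - intros (v & q & s' & Es & Hs). apply encode_inj in Es. subst s'.
    unfold s in Hs. inversion Hs as [| | | | | |f g ? u ? p r Hg Hf| | | |]; subst.
    assert (Hu : u = pack x 0).
    { eapply eval_functional; [exact Hg|].
      refine (eval_Pair' _ _ _ _ _ _ [] [] _ (eval_Zero _ _)).
      rewrite <- (pack_pi x) at 2.
      exact (eval_Pair' _ _ _ _ _ _ [] [] (eval_Left' _ _) (eval_Right' _ _)). }
    subst u. clear Hs Hg.
    (* The starting point changes from one round of the search to the next, so the program and the
       input are generalized before the induction on the evaluation. *)
    assert (E : forall d z v r, eval (fun _ => False) d z v r -> d = Mu c ->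
              P (pi1 z) v = true).
    { intros d z w r' He. induction He; intros Ed; try discriminate Ed;
        injection Ed as ->.
      - change (Cantor.to_nat (a, n)) with (pack a n) in *. rewrite pi1_pack.
        destruct (eval_functional _ _ _ _ _ _ _ He (Hv a n)) as [E _].
        destruct (P a n); auto. discriminate E.
      - specialize (IHHe2 eq_refl).
        change (Cantor.to_nat (a, S n)) with (pack a (S n)) in IHHe2.
        change (Cantor.to_nat (a, n)) with (pack a n).
        rewrite pi1_pack in *. exact IHHe2. }
    specialize (E _ _ _ _ Hf eq_refl). rewrite pi1_pack in E. eauto.
Qed.

(** The argument [z] is hard-wired as the constant program [cst z], built from [z] successors; the
    number of that program is primitive recursive in [z]. *)
Lemma smn c :
  exists f, rec f /\ forall z y, W (f z) y <-> W (encode c) (pack z y).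
Proof.
  pose (cst := nat_rect (fun _ => code) Zero (fun _ r => Comp Succ r)).
  pose (s z := Comp c (Pair (cst z) (Pair Left Right))).
  assert (Hs : forall z y, eval (fun _ => False) (Pair (cst z) (Pair Left Right)) y
                 (pack z y) []).
  { intros z y. refine (eval_Pair' _ _ _ _ _ _ [] [] _ _).
    - induction z as [|z IH]; [apply eval_Zero|].
      exact (eval_Comp _ _ _ _ _ _ [] [] IH (eval_Succ _ _)).
    - rewrite <- (pack_pi y) at 2.
      exact (eval_Pair' _ _ _ _ _ _ [] [] (eval_Left' _ _) (eval_Right' _ _)). }
  exists (fun z => encode (s z)). split.
  - apply (rec_ext (fun z => pack 6 (pack (encode c) (pack 5 (pack
      (nat_rect (fun _ => nat) (encode Zero)
        (fun _ r => pack 6 (pack (encode Succ) r)) z)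
      (encode (Pair Left Right))))))); [|solve_rec].
    intros z. unfold s. cbn [encode].
    assert (E : nat_rect (fun _ => nat) (encode Zero)
      (fun _ r => pack 6 (pack (encode Succ) r)) z = encode (cst z)).
    { induction z as [|z IH]; [reflexivity|]. cbn [nat_rect]. rewrite IH. reflexivity. }
    cbn [encode] in E. rewrite E. reflexivity.
  - intros z y. split.
    + intros (v & q & s' & Es & He). apply encode_inj in Es. subst s'.
      unfold s in He. inversion He as [| | | | | |f g ? u ? p r Hg Hf| | | |]; subst.
      destruct (eval_functional _ _ _ _ _ _ _ Hg (Hs z y)) as [-> _].
      exists v, r, c. auto.
    + intros (v & q & c' & Ec & He). apply encode_inj in Ec. subst c'.
      exists v, ([] ++ q), (s z). split; auto.
      exact (eval_Comp _ _ _ _ _ _ _ _ (Hs z y) He).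
Qed.

(** * A universal machine *)

(* A configuration is [pack 0 (pack v k)], returning the value [v] to the stack
   [k], or [pack (S c) (pack x k)], running the program with number [c] on [x].
   A stack is [0] or [S (pack (pack tag data) k)]. *)
Definition ret (v k : nat) : nat := pack 0 (pack v k).
Definition call (c x k : nat) : nat := pack (S c) (pack x k).
Definition push (t d k : nat) : nat := S (pack (pack t d) k).

(** Tag 0 waits for the first component of a pair, 1 for the second, 2 for the inner function of a
    composition, 3 for the previous value of a primitive recursion, and 4 for the test of a search.
    In the last case a nonzero value restarts [Mu], whose constructor tag is 8. *)
Definition step_ret (v k t d : nat) : nat :=
  if t =? 0 then call (pi1 d) (pi2 d) (push 1 v k)
  else if t =? 1 then ret (pack d v) k
  else if t =? 2 then call d v k
  else if t =? 3 then
    call (pi1 d) (pack (pi1 (pi2 d)) (pack (pi2 (pi2 d)) v)) k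
  else if v =? 0 then ret (pi2 (pi2 d)) k
  else call (pack 8 (pi1 d)) (pack (pi1 (pi2 d)) (S (pi2 (pi2 d)))) k.

(** The tag [t] is that of [encode]; an oracle call returns 0 because the oracle is empty. Numbers
    that encode no program are run as well, so soundness can be claimed for [encode c] only. *)
Definition step_call (c x k t d : nat) : nat :=
  if t =? 0 then ret 0 k
  else if t =? 1 then ret (S x) k
  else if t =? 2 then ret (pi1 x) k
  else if t =? 3 then ret (pi2 x) k
  else if t =? 4 then ret 0 k
  else if t =? 5 then call (pi1 d) x (push 0 (pack (pi2 d) x) k)
  else if t =? 6 then call (pi2 d) x (push 2 (pi1 d) k)
  else if t =? 7 then
    if pi2 x =? 0 then call (pi1 d) (pi1 x) k
    else call c (pack (pi1 x) (pred (pi2 x)))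
           (push 3 (pack (pi2 d) (pack (pi1 x) (pred (pi2 x)))) k)
  else call d x (push 4 (pack d x) k).

Definition halted (m : nat) : bool := (pi1 m =? 0) && (pi2 (pi2 m) =? 0).

Definition step (m : nat) : nat :=
  if halted m then m
  else if pi1 m =? 0 then
    step_ret (pi1 (pi2 m)) (pi2 (pred (pi2 (pi2 m))))
      (pi1 (pi1 (pred (pi2 (pi2 m))))) (pi2 (pi1 (pred (pi2 (pi2 m)))))
  else
    step_call (pred (pi1 m)) (pi1 (pi2 m)) (pi2 (pi2 m))
      (pi1 (pred (pi1 m))) (pi2 (pred (pi1 m))).

Definition run (m s : nat) : nat := nat_rect (fun _ => nat) m (fun _ r => step r) s.

(* [z] is the pair of a program number and an input. *)
Definition halts (z s : nat) : bool := halted (run (call (pi1 z) (pi2 z) 0) s).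
Definition out (z s : nat) : nat := pi1 (pi2 (run (call (pi1 z) (pi2 z) 0) s)).

Lemma rec_step f : rec f -> rec (fun x => step (f x)).
Proof.
  intros H. unfold step, step_ret, step_call, halted, ret, call, push. solve_rec.
Qed.
Hint Resolve rec_step : rec.

Lemma rec_run f g : rec f -> rec g -> rec (fun x => run (f x) (g x)).
Proof. intros. unfold run. solve_rec. Qed.
Hint Resolve rec_run : rec.

Lemma dec_halts f g : rec f -> rec g -> dec (fun x => halts (f x) (g x)).
Proof. intros. unfold halts, halted, call. solve_rec. Qed.

Lemma rec_out f g : rec f -> rec g -> rec (fun x => out (f x) (g x)).
Proof. intros. unfold out, call. solve_rec. Qed.
Hint Resolve dec_halts rec_out : rec.

Lemma run_add m s t : run m (s + t) = run (run m s) t.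
Proof.
  unfold run. rewrite Nat.add_comm. induction t as [|t IH]; [reflexivity|].
  simpl. now rewrite IH.
Qed.

Lemma halted_run m t : halted m = true -> run m t = m.
Proof.
  intros H. induction t as [|t IH]; [reflexivity|].
  change (run m (S t)) with (step (run m t)). rewrite IH. unfold step.
  now rewrite H.
Qed.

Lemma step_ret_push v t d k : step (ret v (push t d k)) = step_ret v k t d.
Proof.
  unfold step, halted, ret, push.
  now rewrite ?pi1_pack, ?pi2_pack, ?pi1_pack, ?pi2_pack; simpl;
    rewrite ?pi1_pack, ?pi2_pack, ?pi1_pack, ?pi2_pack.
Qed.

Lemma step_call_pack t d x k : step (call (pack t d) x k) = step_call (pack t d) x k t d.
Proof.
  unfold step, halted, call.
  now rewrite ?pi1_pack, ?pi2_pack, ?pi1_pack, ?pi2_pack; simpl;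
    rewrite ?pi1_pack, ?pi2_pack, ?pi1_pack, ?pi2_pack.
Qed.

Lemma halted_call c x k : halted (call c x k) = false.
Proof. unfold halted, call. now rewrite pi1_pack. Qed.

Lemma run_step m n s : step m = n -> run m (S s) = run n s.
Proof. intros <-. exact (run_add m 1 s). Qed.

Ltac machine_step :=
  rewrite ?step_ret_push, ?step_call_pack; unfold step_ret, step_call; simpl;
  rewrite ?pi1_pack, ?pi2_pack, ?pi1_pack, ?pi2_pack; simpl; try reflexivity.

Lemma step_Pair f g x k :
  step (call (encode (Pair f g)) x k) =
  call (encode f) x (push 0 (pack (encode g) x) k).
Proof. change (encode (Pair f g)) with (pack 5 (pack (encode f) (encode g))). machine_step. Qed.

Lemma step_Comp f g x k :
  step (call (encode (Comp f g)) x k) = call (encode g) x (push 2 (encode f) k).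
Proof. change (encode (Comp f g)) with (pack 6 (pack (encode f) (encode g))). machine_step. Qed.

Lemma step_Prec_0 f g a k :
  step (call (encode (Prec f g)) (pack a 0) k) = call (encode f) a k.
Proof. change (encode (Prec f g)) with (pack 7 (pack (encode f) (encode g))). machine_step. Qed.

Lemma step_Prec_S f g a n k :
  step (call (encode (Prec f g)) (pack a (S n)) k) =
  call (encode (Prec f g)) (pack a n) (push 3 (pack (encode g) (pack a n)) k).
Proof. change (encode (Prec f g)) with (pack 7 (pack (encode f) (encode g))). machine_step. Qed.

Lemma step_Mu f x k :
  step (call (encode (Mu f)) x k) =
  call (encode f) x (push 4 (pack (encode f) x) k).
Proof. change (encode (Mu f)) with (pack 8 (encode f)). machine_step. Qed.

Lemma step_PairL v g x k :
  step (ret v (push 0 (pack g x) k)) = call g x (push 1 v k).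
Proof. machine_step. Qed.

Lemma step_PairR w v k : step (ret w (push 1 v k)) = ret (pack v w) k.
Proof. machine_step. Qed.

Lemma step_CompR v f k : step (ret v (push 2 f k)) = call f v k.
Proof. machine_step. Qed.

Lemma step_PrecR v g a n k :
  step (ret v (push 3 (pack g (pack a n)) k)) = call g (pack a (pack n v)) k.
Proof. machine_step. Qed.

Lemma step_MuR_0 f a n k : step (ret 0 (push 4 (pack f (pack a n)) k)) = ret n k.
Proof. machine_step. Qed.

Lemma step_MuR_S f a n v k :
  step (ret (S v) (push 4 (pack (encode f) (pack a n)) k)) =
  call (encode (Mu f)) (pack a (S n)) k.
Proof. change (encode (Mu f)) with (pack 8 (encode f)). machine_step. Qed.

Lemma chi_empty x : chi (fun _ => False) x = 0.
Proof. unfold chi. now destruct ClassicalEpsilon.excluded_middle_informative. Qed.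

(** The stack is arbitrary because subprograms run above the frames of their callers. *)
Lemma run_complete c x v q :
  eval (fun _ => False) c x v q ->
  forall k, exists s, run (call (encode c) x k) s = ret v k.
Proof.
  intros H. induction H; intros stk.
  - exists 1. apply (step_call_pack 0 0).
  - exists 1. apply (step_call_pack 1 0).
  - exists 1. apply (step_call_pack 2 0).
  - exists 1. apply (step_call_pack 3 0).
  - exists 1. rewrite chi_empty. apply (step_call_pack 4 0).
  - destruct (IHeval1 (push 0 (pack (encode g) x) stk)) as [s Hs].
    destruct (IHeval2 (push 1 v stk)) as [t Ht].
    exists (S (s + S (t + 1))). rewrite (run_step _ _ _ (step_Pair f g x stk)), run_add, Hs.
    rewrite (run_step _ _ _ (step_PairL _ _ _ _)), run_add, Ht.
    exact (step_PairR w v stk).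
  - destruct (IHeval1 (push 2 (encode f) stk)) as [s Hs].
    destruct (IHeval2 stk) as [t Ht].
    exists (S (s + S t)). rewrite (run_step _ _ _ (step_Comp f g x stk)), run_add, Hs.
    now rewrite (run_step _ _ _ (step_CompR _ _ _)).
  - destruct (IHeval stk) as [s Hs]. exists (S s).
    now rewrite (run_step _ _ _ (step_Prec_0 f g a stk)).
  - destruct (IHeval1 (push 3 (pack (encode g) (pack a n)) stk)) as [s Hs].
    destruct (IHeval2 stk) as [t Ht].
    exists (S (s + S t)).
    change (Cantor.to_nat (a, S n)) with (pack a (S n)).
    rewrite (run_step _ _ _ (step_Prec_S f g a n stk)), run_add.
    change (pack a n) with (Cantor.to_nat (a, n)) at 1. rewrite Hs.
    now rewrite (run_step _ _ _ (step_PrecR _ _ _ _ _)).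
  - destruct (IHeval (push 4 (pack (encode f) (pack a n)) stk)) as [s Hs].
    exists (S (s + 1)). rewrite (run_step _ _ _ (step_Mu f _ stk)), run_add.
    change (Cantor.to_nat (a, n)) with (pack a n) in *. rewrite Hs.
    exact (step_MuR_0 _ _ _ _).
  - destruct (IHeval1 (push 4 (pack (encode f) (pack a n)) stk)) as [s Hs].
    destruct (IHeval2 stk) as [t Ht].
    exists (S (s + S t)). rewrite (run_step _ _ _ (step_Mu f _ stk)), run_add.
    change (Cantor.to_nat (a, n)) with (pack a n) in *. rewrite Hs.
    rewrite (run_step _ _ _ (step_MuR_S _ _ _ _ _)). exact Ht.
Qed.

Lemma run_call_halted c x k s :
  halted (run (call c x k) s) = true ->
  exists r, s = S r /\ halted (run (step (call c x k)) r) = true.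
Proof.
  destruct s as [|r]; intros H.
  - change (halted (call c x k) = true) in H. rewrite halted_call in H. discriminate.
  - exists r. split; auto. now rewrite <- (run_step _ _ _ eq_refl).
Qed.

Lemma run_push_halted v t d k s :
  halted (run (ret v (push t d k)) s) = true ->
  exists r, s = S r /\ halted (run (step (ret v (push t d k))) r) = true.
Proof.
  destruct s as [|r]; intros H.
  - change (halted (ret v (push t d k)) = true) in H.
    unfold halted, ret in H. rewrite !pi2_pack in H.
    rewrite andb_comm in H. discriminate H.
  - exists r. split; auto. now rewrite <- (run_step _ _ _ eq_refl).
Qed.

(** A run that halts has emptied its stack, so it must first return a value to [k]. The rest of the
    run is strictly shorter, and strong induction on the number of steps covers the next subprogram
    too. *)
Lemma run_sound s c x k :
  halted (run (call (encode c) x k) s) = true ->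
  exists v q r, r < s /\ eval (fun _ => False) c x v q /\
    halted (run (ret v k) r) = true.
Proof.
  revert c x k. induction s as [s IH] using lt_wf_ind. intros c x k H.
  apply run_call_halted in H. destruct H as (r & -> & H).
  destruct c as [| | | | |f g|f g|f g|f].
  - rewrite (step_call_pack 0 0) in H. exists 0, [], r. repeat split; auto. apply eval_Zero.
  - rewrite (step_call_pack 1 0) in H. exists (S x), [], r. repeat split; auto. apply eval_Succ.
  - rewrite (step_call_pack 2 0) in H. exists (pi1 x), [], r. repeat split; auto. apply eval_Left.
  - rewrite (step_call_pack 3 0) in H. exists (pi2 x), [], r. repeat split; auto. apply eval_Right.
  - rewrite (step_call_pack 4 0) in H. exists 0, [x], r. repeat split; auto.
    rewrite <- (chi_empty x). apply eval_Oracle.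
  - rewrite step_Pair in H. apply IH in H; [|lia].
    destruct H as (v & p & r1 & L1 & Ef & H).
    apply run_push_halted in H. destruct H as (r2 & -> & H).
    rewrite step_PairL in H. apply IH in H; [|lia].
    destruct H as (w & q & r3 & L3 & Eg & H).
    apply run_push_halted in H. destruct H as (r4 & -> & H).
    rewrite step_PairR in H.
    exists (pack v w), (p ++ q), r4. repeat split; [lia| |auto].
    apply eval_Pair'; auto.
  - rewrite step_Comp in H. apply IH in H; [|lia].
    destruct H as (v & p & r1 & L1 & Ef & H).
    apply run_push_halted in H. destruct H as (r2 & -> & H).
    rewrite step_CompR in H. apply IH in H; [|lia].
    destruct H as (w & q & r3 & L3 & Eg & H).
    exists w, (p ++ q), r3. repeat split; [lia| |auto].
    eapply eval_Comp; eauto.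
  - rewrite <- (pack_pi x) in H |- *. generalize dependent (pi1 x). intros a H.
    destruct (pi2 x) as [|n].
    + rewrite step_Prec_0 in H. apply IH in H; [|lia].
      destruct H as (v & p & r1 & L1 & Ef & H).
      exists v, p, r1. repeat split; [lia| |auto]. apply eval_Prec_0, Ef.
    + rewrite step_Prec_S in H. apply IH in H; [|lia].
      destruct H as (v & p & r1 & L1 & Ef & H).
      apply run_push_halted in H. destruct H as (r2 & -> & H).
      rewrite step_PrecR in H. apply IH in H; [|lia].
      destruct H as (w & q & r3 & L3 & Eg & H).
      exists w, (p ++ q), r3. repeat split; [lia| |auto].
      eapply eval_Prec_S; eauto.
  - rewrite step_Mu in H. apply IH in H; [|lia].
    destruct H as (v & p & r1 & L1 & Ef & H).
    apply run_push_halted in H. destruct H as (r2 & -> & H).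
    rewrite <- (pack_pi x) in H, Ef |- *.
    generalize dependent (pi1 x). generalize (pi2 x). intros n a Ef H.
    destruct v as [|v].
    + rewrite step_MuR_0 in H. exists n, p, r2. repeat split; [lia| |auto].
      apply eval_Mu_stop, Ef.
    + rewrite step_MuR_S in H. apply IH in H; [|lia].
      destruct H as (w & q & r3 & L3 & Eg & H).
      exists w, (p ++ q), r3. repeat split; [lia| |auto].
      eapply eval_Mu_next; eauto.
Qed.

Lemma halts_mono z s t : s <= t -> halts z s = true -> halts z t = true.
Proof.
  intros L H. unfold halts in *. replace t with (s + (t - s)) by lia.
  rewrite run_add, halted_run; auto.
Qed.

Lemma out_stable z s t :
  halts z s = true -> halts z t = true -> out z s = out z t.
Proof.
  assert (E : forall s t, s <= t -> halts z s = true -> out z s = out z t).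
  { clear. intros s t L H. unfold halts, out in *. replace t with (s + (t - s)) by lia.
    rewrite run_add, (halted_run (run _ s)); auto. }
  intros Hs Ht. destruct (Nat.le_ge_cases s t); [|symmetry]; apply E; auto.
Qed.

Lemma halts_complete e x v :
  phi e x v -> exists s, halts (pack e x) s = true /\ out (pack e x) s = v.
Proof.
  intros (q & c & <- & H). destruct (run_complete _ _ _ _ H 0) as [s Hs].
  exists s. unfold halts, out. rewrite pi1_pack, pi2_pack, Hs.
  unfold halted, ret. now rewrite !pi2_pack, !pi1_pack.
Qed.

Lemma halts_sound c x s : halts (pack (encode c) x) s = true -> W (encode c) x.
Proof.
  unfold halts. rewrite pi1_pack, pi2_pack. intros H.
  apply run_sound in H. destruct H as (v & q & _ & _ & H & _).
  exists v, q, c. auto.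
Qed.

(** * The construction *)

(* The element [pack x k] belongs to the block of [x].  A state is a pair of bit
   sets: the elements enumerated so far one by one, and the marked witnesses.
   Besides, [pack x k] with [2 <= k] is enumerated as soon as [x] halts. *)
Definition stored (c y : nat) : bool := Nat.testbit (pi1 c) y.
Definition marked (c w : nat) : bool := Nat.testbit (pi2 c) w.

Definition in_A (c s y : nat) : bool :=
  stored c y || ((2 <=? pi2 y) && halts (pi1 y) s).

Definition subset_A (c s v : nat) : bool :=
  allb (fun y => negb (Nat.testbit v y) || in_A c s y) v.

(* The [i]-th witness against the [e]-th reduction is [pack e i]. *)
Definition conv (e i s : nat) : bool := halts (pack e (pack e i)) s.
(** Meaningful once [conv e i s] holds, and constant from then on: the canonical index of F(e,i). *)
Definition value (e i s : nat) : nat := out (pack e (pack e i)) s.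

Definition finished (c s e i : nat) : bool :=
  marked c (pack e i) && subset_A c s (value e i s).

(** Marked witnesses are bits of [pi2 c], so their indices lie below [pi2 c]. Hence the index
    [pi2 c] is itself unfinished, and the default value of [least] is correct. *)
Definition current (c s e : nat) : nat :=
  least (fun i => negb (finished c s e i)) (pi2 c).

Definition guards (c s e y : nat) : bool :=
  marked c (pack e (current c s e)) &&
  Nat.testbit (value e (current c s e) s) y.

(** A smaller value is a stronger guard. An unguarded element gets [pi2 c], which exceeds the index
    of every guard. *)
Definition priority (c s y : nat) : nat :=
  least (fun e => guards c s e y) (pi2 c).

(** The less strongly guarded element is sacrificed, so the priority of its partner is at most its
    own; a tie goes to 1. *)
Definition choice (c s x : nat) : nat :=
  if priority c s (pack x 0) <=? priority c s (pack x 1) then 1 else 0.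

Definition encode_block (c s x : nat) : nat :=
  if halts x s && (negb (stored c (pack x 0)) && negb (stored c (pack x 1)))
  then pack (Nat.setbit (pi1 c) (pack x (choice c s x))) (pi2 c)
  else c.

(** The restriction to blocks from [e] on leaves the column of each block exposed to finitely many
    requirements only, which is what keeps the column of a number outside [K] finite. *)
Definition dump (e v a : nat) : nat :=
  nat_rect (fun _ => nat) a
    (fun y r => if Nat.testbit v y && ((2 <=? pi2 y) && (e <=? pi1 y))
                then Nat.setbit r y else r) v.

(** If dumping alone brings F(e,i) into [A], the witness is kept out of [B] and refutes the
    reduction; otherwise it is marked. Inclusion is tested at [S s], the stage to which the new
    state belongs. *)
Definition attack (c s e i : nat) : nat :=
  let c' := pack (dump e (value e i s) (pi1 c)) (pi2 c) in
  if conv e i s && negb (marked c (pack e i)) then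
    if subset_A c' (S s) (value e i s) then c'
    else pack (pi1 c') (Nat.setbit (pi2 c) (pack e i))
  else c.

(** A stage is read as [pack (pack x k) r]: [k = 0] treats the block of [x], any other [k] the
    requirement [x]. As [r] is free, each task recurs at arbitrarily late stages. *)
Definition next (s c : nat) : nat :=
  if pi2 (pi1 s) =? 0 then encode_block c s (pi1 (pi1 s))
  else attack c s (pi1 (pi1 s)) (current c s (pi1 (pi1 s))).

Definition state (s : nat) : nat :=
  nat_rect (fun _ => nat) (pack 0 0) (fun s c => next s c) s.

Definition A (y : nat) : Prop := exists s, in_A (state s) s y = true.
Definition B (w : nat) : Prop := exists s, marked (state s) w = true.

(** * Computability of the construction *)

Lemma dec_stored f g : rec f -> rec g -> dec (fun x => stored (f x) (g x)).
Proof. intros. unfold stored. solve_rec. Qed.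

Lemma dec_marked f g : rec f -> rec g -> dec (fun x => marked (f x) (g x)).
Proof. intros. unfold marked. solve_rec. Qed.
Hint Resolve dec_stored dec_marked : rec.

Lemma dec_in_A f g h :
  rec f -> rec g -> rec h -> dec (fun x => in_A (f x) (g x) (h x)).
Proof. intros. unfold in_A. solve_rec. Qed.
Hint Resolve dec_in_A : rec.

Lemma dec_subset_A f g h :
  rec f -> rec g -> rec h -> dec (fun x => subset_A (f x) (g x) (h x)).
Proof. intros. unfold subset_A. solve_rec. Qed.
Hint Resolve dec_subset_A : rec.

Lemma dec_conv f g h :
  rec f -> rec g -> rec h -> dec (fun x => conv (f x) (g x) (h x)).
Proof. intros. unfold conv. solve_rec. Qed.

Lemma rec_value f g h :
  rec f -> rec g -> rec h -> rec (fun x => value (f x) (g x) (h x)).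
Proof. intros. unfold value. solve_rec. Qed.
Hint Resolve dec_conv rec_value : rec.

Lemma rec_current f g h :
  rec f -> rec g -> rec h -> rec (fun x => current (f x) (g x) (h x)).
Proof. intros. unfold current, finished. solve_rec. Qed.
Hint Resolve rec_current : rec.

Lemma rec_priority f g h :
  rec f -> rec g -> rec h -> rec (fun x => priority (f x) (g x) (h x)).
Proof. intros. unfold priority, guards. solve_rec. Qed.
Hint Resolve rec_priority : rec.

Lemma rec_encode_block f g h :
  rec f -> rec g -> rec h -> rec (fun x => encode_block (f x) (g x) (h x)).
Proof. intros. unfold encode_block, choice. solve_rec. Qed.

Lemma rec_dump f g h :
  rec f -> rec g -> rec h -> rec (fun x => dump (f x) (g x) (h x)).
Proof. intros. unfold dump. solve_rec. Qed.
Hint Resolve rec_encode_block rec_dump : rec.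

Lemma rec_attack f g h i :
  rec f -> rec g -> rec h -> rec i ->
  rec (fun x => attack (f x) (g x) (h x) (i x)).
Proof. intros. unfold attack. solve_rec. Qed.
Hint Resolve rec_attack : rec.

Lemma rec_state f : rec f -> rec (fun x => state (f x)).
Proof. intros. unfold state, next. solve_rec. Qed.
Hint Resolve rec_state : rec.

Lemma ce_A : ce A.
Proof.
  destruct (semidecidable (fun y s => in_A (state s) s y)) as [c H]; [solve_rec|].
  exists (encode c). exact H.
Qed.

Lemma ce_B : ce B.
Proof.
  destruct (semidecidable (fun w s => marked (state s) w)) as [c H]; [solve_rec|].
  exists (encode c). exact H.
Qed.

(** * Analysis of a single stage *)

Lemma setbit_true u z y :
  Nat.testbit (Nat.setbit u z) y = true <-> y = z \/ Nat.testbit u y = true.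
Proof. rewrite Nat.setbit_eqb, orb_true_iff, Nat.eqb_eq. intuition congruence. Qed.

Lemma dump_spec e v a y :
  Nat.testbit (dump e v a) y = true <->
  Nat.testbit a y = true \/
  Nat.testbit v y = true /\ 2 <= pi2 y /\ e <= pi1 y.
Proof.
  unfold dump.
  assert (H : forall n, Nat.testbit (nat_rect (fun _ => nat) a
    (fun y r => if Nat.testbit v y && ((2 <=? pi2 y) && (e <=? pi1 y))
                then Nat.setbit r y else r) n) y = true <->
    Nat.testbit a y = true \/
    y < n /\ Nat.testbit v y = true /\ 2 <= pi2 y /\ e <= pi1 y).
  { induction n as [|n IH]; cbn [nat_rect].
    - split; [auto|]. intros [|[L _]]; [auto|lia].
    - assert (L : y < S n <-> y = n \/ y < n) by lia.
      destruct (_ && _) eqn:E.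
      + rewrite !andb_true_iff, !Nat.leb_le in E. rewrite setbit_true, IH, L.
        split; [intros [->|[|]]|intros [|([->|] & H')]]; tauto.
      + rewrite IH, L. split; [tauto|]. intros [|([->|] & H')]; try tauto.
        rewrite <- !Nat.leb_le, <- !andb_true_iff in H'. congruence. }
  rewrite H. split; [tauto|]. intros [|H']; [tauto|]. right.
  split; [apply testbit_lt|]; tauto.
Qed.

Lemma subset_A_spec c s v :
  subset_A c s v = true <->
  forall y, Nat.testbit v y = true -> in_A c s y = true.
Proof.
  unfold subset_A. rewrite allb_spec. split.
  - intros H y Hy. specialize (H y (testbit_lt _ _ Hy)). now rewrite Hy in H.
  - intros H y _. destruct (Nat.testbit v y) eqn:E; simpl; auto.
Qed.

Lemma subset_A_false c s v :
  subset_A c s v = false <->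
  exists y, Nat.testbit v y = true /\ in_A c s y = false.
Proof.
  rewrite <- not_true_iff_false, subset_A_spec. split.
  - intros H. apply not_all_ex_not in H. destruct H as [y H].
    exists y. destruct (Nat.testbit v y), (in_A c s y); tauto.
  - intros (y & H1 & H2) H. rewrite H in H2; auto; discriminate.
Qed.

Lemma marked_lt c e i : marked c (pack e i) = true -> e < pi2 c /\ i < pi2 c.
Proof. intros H. apply testbit_lt in H. pose proof (pack_ge e i). lia. Qed.

Lemma current_unfinished c s e : finished c s e (current c s e) = false.
Proof.
  unfold current.
  destruct (least_spec (fun i => negb (finished c s e i)) (pi2 c)) as (H1 & _ & H2).
  destruct (Nat.eq_dec (least (fun i => negb (finished c s e i)) (pi2 c)) (pi2 c)) as [E|N].
  - rewrite E. destruct (finished c s e (pi2 c)) eqn:F; auto.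
    apply andb_true_iff in F. destruct F as [F _]. apply marked_lt in F. lia.
  - apply negb_true_iff, H2. lia.
Qed.

Lemma current_spec c s e i :
  current c s e = i <->
  finished c s e i = false /\ forall j, j < i -> finished c s e j = true.
Proof.
  assert (H : forall j, j < current c s e -> finished c s e j = true).
  { intros j Hj. apply negb_false_iff.
    now apply (least_spec (fun i => negb (finished c s e i)) (pi2 c)). }
  split.
  - intros <-. split; [apply current_unfinished|auto].
  - intros [F G]. destruct (Nat.lt_trichotomy (current c s e) i) as [L|[|L]]; auto.
    + specialize (G _ L). rewrite current_unfinished in G. discriminate.
    + rewrite H in F by auto. discriminate.
Qed.

Lemma priority_le c s e y : guards c s e y = true -> priority c s y <= e.
Proof. intros H. now apply (least_le (fun e => guards c s e y)). Qed.

Lemma priority_guards c s e y :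
  priority c s y <= e -> e < pi2 c -> guards c s (priority c s y) y = true.
Proof.
  intros L M. unfold priority in *.
  apply (least_spec (fun e => guards c s e y) (pi2 c)). lia.
Qed.

Lemma stored_next s y :
  stored (state (S s)) y = true ->
  stored (state s) y = true \/
  pi2 (pi1 s) = 0 /\ pi1 y = pi1 (pi1 s) /\ pi2 y = choice (state s) s (pi1 y) /\
    halts (pi1 y) s = true /\ stored (state s) (pack (pi1 y) 0) = false /\
    stored (state s) (pack (pi1 y) 1) = false \/
  exists e, e <= pi1 y /\ 2 <= pi2 y /\ conv e (current (state s) s e) s = true /\
    Nat.testbit (value e (current (state s) s e) s) y = true.
Proof.
  change (state (S s)) with (next s (state s)).
  generalize (state s). intros c. unfold next.
  destruct (Nat.eqb_spec (pi2 (pi1 s)) 0) as [E|_].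
  - unfold encode_block. destruct (_ && _) eqn:F; auto.
    rewrite !andb_true_iff, !negb_true_iff in F.
    unfold stored at 1. rewrite pi1_pack, setbit_true. intros [->|]; auto.
    right; left. rewrite pi1_pack, pi2_pack. tauto.
  - unfold attack. set (e := pi1 (pi1 s)). destruct (_ && _) eqn:F; auto.
    apply andb_true_iff in F. intros H.
    assert (H' : Nat.testbit (dump e (value e (current c s e) s) (pi1 c)) y = true).
    { destruct (subset_A _ _ _); unfold stored in H; now rewrite !pi1_pack in H. }
    apply dump_spec in H'. destruct H' as [|(H1 & H2 & H3)]; auto.
    right; right. exists e. tauto.
Qed.

(** The last two clauses serve the injury argument: an element of the guarded set still missing from
    [A] has [k < 2] or lies in a block below [e]. *)
Lemma marked_next s w :
  marked (state (S s)) w = true ->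
  marked (state s) w = true \/
  exists e, w = pack e (current (state s) s e) /\
    conv e (current (state s) s e) s = true /\ marked (state s) w = false /\
    subset_A (state (S s)) (S s) (value e (current (state s) s e) s) = false /\
    forall y, Nat.testbit (value e (current (state s) s e) s) y = true ->
      2 <= pi2 y -> e <= pi1 y -> stored (state (S s)) y = true.
Proof.
  change (state (S s)) with (next s (state s)).
  generalize (state s). intros c. unfold next.
  destruct (Nat.eqb_spec (pi2 (pi1 s)) 0) as [E|_].
  - unfold encode_block. destruct (_ && _) eqn:F; auto.
    unfold marked at 1. rewrite pi2_pack. auto.
  - unfold attack. set (e := pi1 (pi1 s)). set (i := current c s e).
    destruct (_ && _) eqn:F; auto.
    apply andb_true_iff in F. destruct F as [F1 F2]. apply negb_true_iff in F2.
    destruct (subset_A _ _ _) eqn:Sub.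
    + unfold marked at 1. rewrite pi2_pack. auto.
    + unfold marked at 1. rewrite pi2_pack, setbit_true. intros [->|]; auto.
      right. exists e. fold i. repeat split; auto.
      * rewrite <- Sub. unfold subset_A, in_A, stored. now rewrite !pi1_pack.
      * intros y H1 H2 H3. unfold stored. rewrite !pi1_pack. apply dump_spec. auto.
Qed.

(** * Monotonicity in the stage *)

Lemma stored_mono s t y :
  s <= t -> stored (state s) y = true -> stored (state t) y = true.
Proof.
  intros L H. induction L as [|t _ IH]; auto. revert IH.
  change (state (S t)) with (next t (state t)). generalize (state t). clear.
  intros c H. unfold next, encode_block, attack.
  destruct (_ =? _); destruct (_ && _); auto;
    try destruct (subset_A _ _ _); unfold stored in *; rewrite ?pi1_pack;
    rewrite ?setbit_true, ?dump_spec; auto.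
Qed.

Lemma marked_mono s t w :
  s <= t -> marked (state s) w = true -> marked (state t) w = true.
Proof.
  intros L H. induction L as [|t _ IH]; auto. revert IH.
  change (state (S t)) with (next t (state t)). generalize (state t). clear.
  intros c H. unfold next, encode_block, attack.
  destruct (_ =? _); destruct (_ && _); auto;
    try destruct (subset_A _ _ _); unfold marked in *; rewrite ?pi2_pack;
    rewrite ?setbit_true; auto.
Qed.

Lemma in_A_mono s t y :
  s <= t -> in_A (state s) s y = true -> in_A (state t) t y = true.
Proof.
  unfold in_A. rewrite !orb_true_iff, !andb_true_iff.
  intros L [H|[H1 H2]]; [left; eapply stored_mono|right; split; [|eapply halts_mono]]; eauto.
Qed.

Lemma conv_mono e i s t : s <= t -> conv e i s = true -> conv e i t = true.
Proof. apply halts_mono. Qed.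

Lemma value_stable e i s t :
  conv e i s = true -> conv e i t = true -> value e i s = value e i t.
Proof. apply out_stable. Qed.

Lemma marked_conv s e i : marked (state s) (pack e i) = true -> conv e i s = true.
Proof.
  induction s as [|s IH]; intros H.
  - unfold marked in H. simpl in H. rewrite pi2_pack, Nat.bits_0 in H. discriminate.
  - apply marked_next in H. destruct H as [H|(e' & E & H & _)].
    + eapply conv_mono; [|apply IH, H]. lia.
    + assert (e' = e) by (rewrite <- (pi1_pack e i), E; apply eq_sym, pi1_pack).
      subst e'. apply (conv_mono e i s); [lia|].
      rewrite <- (pi2_pack e i), E, pi2_pack. exact H.
Qed.

(** Marks persist, the converged value is fixed and [A] grows. Hence the current witness never moves
    back. *)
Lemma finished_mono s t e i :
  s <= t -> finished (state s) s e i = true -> finished (state t) t e i = true.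
Proof.
  intros L H. apply andb_true_iff in H. destruct H as [H1 H2].
  apply andb_true_iff. split; [eapply marked_mono; eauto|].
  apply subset_A_spec. intros y Hy. apply (in_A_mono s); auto.
  rewrite subset_A_spec in H2. apply H2.
  apply marked_conv in H1.
  rewrite (value_stable e i s t); auto. eapply conv_mono; eauto.
Qed.

(** Elements with [k < 2] enter only by [encode_block], which requires both to be absent and picks
    one. *)
Lemma stored_block s x :
  ~ (stored (state s) (pack x 0) = true /\ stored (state s) (pack x 1) = true).
Proof.
  induction s as [|s IH]; intros [H0 H1].
  - unfold stored in H0. simpl in H0. rewrite pi1_pack, Nat.bits_0 in H0. discriminate.
  - apply stored_next in H0, H1. rewrite !pi1_pack, !pi2_pack in *.
    destruct H0 as [H0|[H0|(? & ? & ? & _)]]; [| |lia];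
      destruct H1 as [H1|[H1|(? & ? & ? & _)]]; [| |lia| | |lia].
    + tauto.
    + destruct H1 as (_ & _ & _ & _ & E & _). congruence.
    + destruct H0 as (_ & _ & _ & _ & _ & E). congruence.
    + destruct H0 as (_ & _ & E & _), H1 as (_ & _ & E' & _). congruence.
Qed.

(** * Finite injury *)

Lemma common_bound (P : nat -> nat -> Prop) M :
  (forall i n m, n <= m -> P i n -> P i m) ->
  (forall i, i < M -> exists n, P i n) -> exists n, forall i, i < M -> P i n.
Proof.
  intros Mono H. induction M as [|M IH]; [exists 0; lia|].
  destruct IH as [n Hn]; [intros; apply H; lia|].
  destruct (H M) as [m Hm]; [lia|]. exists (n + m). intros i Hi.
  destruct (Nat.eq_dec i M) as [->|].
  - apply (Mono M m); auto; lia.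
  - apply (Mono i n); [lia|apply Hn; lia].
Qed.

Lemma stabilizes (P : nat -> nat -> bool) M :
  (forall i s t, s <= t -> P i s = true -> P i t = true) ->
  exists s, forall i t, i < M -> P i t = true -> P i s = true.
Proof.
  intros Mono.
  destruct (common_bound (fun i s => forall t, P i t = true -> P i s = true) M) as [s Hs].
  - intros i n m L H t Ht. apply (Mono i n); eauto.
  - intros i _. destruct (classic (exists t, P i t = true)) as [[t Ht]|N].
    + exists t. auto.
    + exists 0. intros t Ht. destruct N; eauto.
  - exists s. intros i t Hi. apply Hs, Hi.
Qed.

Definition finitely_marked (e : nat) : Prop :=
  exists M, forall s i, marked (state s) (pack e i) = true -> i < M.

(** All witnesses before the current one are marked, so the current index is bounded, and only
    finitely many finite sets are ever considered. *)
Lemma value_bound e :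
  finitely_marked e ->
  exists N, forall s y, conv e (current (state s) s e) s = true ->
    Nat.testbit (value e (current (state s) s e) s) y = true -> y < N.
Proof.
  intros [M HM].
  destruct (common_bound (fun i N => forall s, conv e i s = true -> value e i s <= N)
    (S M)) as [N HN].
  - intros i n m L H s Hs. specialize (H s Hs). lia.
  - intros i _. destruct (classic (exists s, conv e i s = true)) as [[s Hs]|No].
    + exists (value e i s). intros t Ht. now rewrite (value_stable e i t s).
    + exists 0. intros s Hs. destruct No; eauto.
  - exists N. intros s y Hc Hy. apply testbit_lt in Hy.
    assert (Hi : current (state s) s e < S M).
    { destruct (Nat.lt_ge_cases (current (state s) s e) (S M)) as [|L]; auto.
      destruct (proj1 (current_spec (state s) s e _) eq_refl) as [_ Q].
      specialize (Q M L). apply andb_true_iff in Q. destruct Q as [Q _].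
      apply HM in Q. lia. }
    specialize (HN _ Hi s Hc). lia.
Qed.

Lemma common_value_bound e :
  (forall e', e' < e -> finitely_marked e') ->
  exists N, forall e' s y, e' < e -> conv e' (current (state s) s e') s = true ->
    Nat.testbit (value e' (current (state s) s e') s) y = true -> y < N.
Proof.
  intros H.
  destruct (common_bound (fun e' N => forall s y,
    conv e' (current (state s) s e') s = true ->
    Nat.testbit (value e' (current (state s) s e') s) y = true -> y < N) e) as [N HN].
  - intros i n m L P s y H1 H2. specialize (P s y H1 H2). lia.
  - intros e' L. apply value_bound, H, L.
  - exists N. intros e' s y L. apply HN, L.
Qed.

(** Column elements of a block below [e] are stored only by dumping for some [e'] not above that
    block, hence below [e], and these requirements handle boundedly many elements. *)
Lemma block_bound e :
  (forall e', e' < e -> finitely_marked e') ->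
  exists N, forall s y, pi1 y < e -> 2 <= pi2 y -> stored (state s) y = true -> y < N.
Proof.
  intros H. destruct (common_value_bound e H) as [N HN]. exists N.
  intros s y Hy1 Hy2. induction s as [|s IH]; intros Hs.
  - unfold stored in Hs. simpl in Hs. rewrite pi1_pack, Nat.bits_0 in Hs. discriminate.
  - apply stored_next in Hs. destruct Hs as [Hs|[Hs|Hs]]; auto.
    + destruct Hs as (_ & _ & E & _). unfold choice in E. destruct (_ <=? _); lia.
    + destruct Hs as (e' & L & _ & H1 & H2). apply (HN e' s); auto; lia.
Qed.

Lemma late_mark e t :
  ~ finitely_marked e ->
  exists s, t <= s /\ conv e (current (state s) s e) s = true /\
    marked (state (S s)) (pack e (current (state s) s e)) = true /\
    marked (state s) (pack e (current (state s) s e)) = false /\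
    subset_A (state (S s)) (S s) (value e (current (state s) s e) s) = false /\
    forall y, Nat.testbit (value e (current (state s) s e) s) y = true ->
      2 <= pi2 y -> e <= pi1 y -> stored (state (S s)) y = true.
Proof.
  intros Inf. apply NNPP. intros No. apply Inf.
  (* With no new mark from stage [t] on, every marked witness is already a bit of
     [pi2 (state t)]. *)
  exists (pi2 (state t)). intros s i Hs.
  assert (Ht : marked (state t) (pack e i) = true); [|now apply marked_lt in Ht].
  destruct (Nat.le_gt_cases s t) as [L|L]; [eapply marked_mono; eauto|].
  induction s as [|s IH]; [lia|].
  destruct (marked (state s) (pack e i)) eqn:E.
  - destruct (Nat.eq_dec s t) as [<-|]; [exact E|]. apply IH; auto. lia.
  - destruct No. exists s. split; [lia|]. pose proof Hs as Hs'. apply marked_next in Hs'.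
    destruct Hs' as [Hs'|(e' & E1 & E2 & E3 & E4 & E5)]; [congruence|].
    assert (e = e') by (rewrite <- (pi1_pack e i), E1; apply pi1_pack). subst e'.
    rewrite <- E1. tauto.
Qed.

Lemma entry_stage s t y :
  s <= t -> stored (state s) y = false -> stored (state t) y = true ->
  exists r, s <= r < t /\ stored (state r) y = false /\ stored (state (S r)) y = true.
Proof.
  intros L Hs. induction L as [|t L IH]; intros Ht; [congruence|].
  destruct (stored (state t) y) eqn:E.
  - destruct (IH eq_refl) as (r & ? & ?). exists r. split; [lia|tauto].
  - exists t. split; [lia|tauto].
Qed.

Lemma finitely_marked_all e : finitely_marked e.
Proof.
  induction e as [e IH] using lt_wf_ind. apply NNPP. intros Inf.
  destruct (common_value_bound e IH) as [N HN].
  destruct (block_bound e IH) as [M HM].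
  (* After these three stages the following is settled: which blocks below [N] have been encoded,
     which column elements of blocks below [e] have been dumped, and which numbers below [e] have
     halted. *)
  destruct (stabilizes (fun x s => stored (state s) (pack x 0) || stored (state s) (pack x 1)) N)
    as [s1 H1].
  { intros x s t L. rewrite !orb_true_iff. intros [|]; [left|right]; eapply stored_mono; eauto. }
  destruct (stabilizes (fun y s => stored (state s) y) M) as [s2 H2].
  { intros y s t L. now apply stored_mono. }
  destruct (stabilizes (fun x s => halts x s) e) as [s3 H3].
  { intros x s t L. now apply halts_mono. }
  (* Two late marks are taken: by the time [t] of the second, the witness [i] marked at [s] must
     have become finished. *)
  destruct (late_mark e (s1 + s2 + s3) Inf) as (s & Ls & Hc & Hm & Hu & Hsub & Hd).
  destruct (late_mark e (S s) Inf) as (t & Lt & _ & _ & Hu' & _ & _).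
  remember (current (state s) s e) as i eqn:Ei. symmetry in Ei.
  remember (current (state t) t e) as i' eqn:Ei'. symmetry in Ei'.
  apply current_spec in Ei, Ei'. destruct Ei as [Fi Gi], Ei' as [Fi' Gi'].
  assert (Hmt : marked (state t) (pack e i) = true) by (eapply marked_mono; eauto).
  assert (Li : i < i').
  { destruct (Nat.lt_trichotomy i i') as [|[->|L]]; auto; [congruence|].
    specialize (Gi _ L). apply (finished_mono s t) in Gi; [congruence|lia]. }
  specialize (Gi' _ Li). apply andb_true_iff in Gi'. destruct Gi' as [_ Sub].
  rewrite (value_stable e i t s) in Sub by (auto using marked_conv).
  rewrite subset_A_spec in Sub. apply subset_A_false in Hsub.
  destruct Hsub as (y & Hy & Hn). pose proof (Sub y Hy) as Hyt.
  unfold in_A in Hn. apply orb_false_iff in Hn. destruct Hn as [Hn1 Hn2].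
  (* A missing column element would have been dumped at [s] if its block is at least [e]; in a block
     below [e] it could no longer enter. *)
  assert (K : pi2 y < 2).
  { destruct (Nat.lt_ge_cases (pi2 y) 2) as [|K]; auto. exfalso.
    destruct (Nat.le_gt_cases e (pi1 y)) as [L|L].
    - rewrite Hd in Hn1 by auto. discriminate.
    - rewrite (proj2 (Nat.leb_le _ _) K) in Hn2. simpl in Hn2.
      unfold in_A in Hyt. apply orb_true_iff in Hyt. destruct Hyt as [Hyt|Hyt].
      + pose proof (HM t y L K Hyt) as Ly. apply (H2 y t) in Hyt; auto.
        apply (stored_mono s2 (S s)) in Hyt; [congruence|lia].
      + apply andb_true_iff in Hyt. destruct Hyt as [_ Hyt].
        apply (H3 _ t L) in Hyt. apply (halts_mono _ s3 (S s)) in Hyt; [congruence|lia]. }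
  assert (Hst : forall z, pi2 z < 2 -> in_A (state t) t z = true -> stored (state t) z = true).
  { intros z Kz Hz. unfold in_A in Hz. apply orb_true_iff in Hz.
    destruct Hz as [|Hz]; auto. apply andb_true_iff in Hz. destruct Hz as [Hz _].
    apply Nat.leb_le in Hz. lia. }
  destruct (entry_stage (S s) t y) as (r & Lr & Hr & Hr'); auto.
  assert (Hcr : conv e i r = true) by (eapply conv_mono; [|exact Hc]; lia).
  (* While [y] is missing, [i] stays unfinished, so [e] still guards F(e,i) at the stage [r] where
     [y] enters. *)
  assert (Er : current (state r) r e = i).
  { apply current_spec. split.
    - destruct (finished (state r) r e i) eqn:F; auto.
      apply andb_true_iff in F. destruct F as [_ F].
      rewrite (value_stable e i r s) in F by auto.
      rewrite subset_A_spec in F. specialize (F y Hy). unfold in_A in F.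
      rewrite Hr in F. apply andb_true_iff in F. destruct F as [F _].
      apply Nat.leb_le in F. lia.
    - intros j Hj. apply (finished_mono s r); auto. lia. }
  assert (Hgy : guards (state r) r e y = true).
  { unfold guards. rewrite Er, (value_stable e i r s), Hy by auto.
    rewrite (marked_mono (S s) r) by (auto; lia). reflexivity. }
  apply stored_next in Hr'.
  destruct Hr' as [Hr'|[Hr'|(? & ? & ? & _)]]; [congruence| |lia].
  destruct Hr' as (_ & _ & Ch & _ & N0 & N1).
  (* The partner of [y]: as [y] was the one chosen, [p] is guarded at least as strongly. *)
  set (p := pack (pi1 y) (1 - pi2 y)).
  assert (Pr : priority (state r) r p <= e).
  { apply Nat.le_trans with (priority (state r) r y); [|now apply priority_le].
    unfold choice in Ch. subst p. pose proof (pack_pi y) as Py.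
    destruct (Nat.leb_spec (priority (state r) r (pack (pi1 y) 0))
      (priority (state r) r (pack (pi1 y) 1))) as [Lp|Lp];
      rewrite Ch in *; rewrite Py in Lp; simpl; lia. }
  assert (Hgp : guards (state r) r (priority (state r) r p) p = true).
  { apply (priority_guards _ _ e); auto. unfold guards in Hgy.
    apply andb_true_iff in Hgy. destruct Hgy as [Hgy _]. apply marked_lt in Hgy. tauto. }
  unfold guards in Hgp. apply andb_true_iff in Hgp. destruct Hgp as [Mp Vp].
  (* If [e] itself is the strongest guard of [p], both partners lie in F(e,i) and would both be in
     [A] by stage [t]. If the guard is stronger, then [p < N], so the block was settled by [s1], yet
     it is encoded at [r]. *)
  destruct (Nat.eq_dec (priority (state r) r p) e) as [E|Ne].
  - rewrite E, Er, (value_stable e i r s) in Vp by auto.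
    assert (S1 : stored (state t) p = true).
    { apply Hst; [subst p; rewrite pi2_pack; lia|auto]. }
    assert (S2 : stored (state t) y = true) by (apply Hst; auto).
    apply (stored_block t (pi1 y)). subst p. rewrite <- (pack_pi y) in S2.
    destruct (pi2 y) as [|[|]]; [auto|auto|lia].
  - apply marked_conv in Mp.
    assert (Lp : p < N) by (apply (HN (priority (state r) r p) r p); auto; lia).
    assert (Lx : pi1 y < N) by (pose proof (pack_ge (pi1 y) (1 - pi2 y)); subst p; lia).
    assert (Q : stored (state s1) (pack (pi1 y) 0) || stored (state s1) (pack (pi1 y) 1) = true).
    { apply (H1 _ t Lx). assert (S2 : stored (state t) y = true) by (apply Hst; auto).
      rewrite <- (pack_pi y) in S2. apply orb_true_iff.
      destruct (pi2 y) as [|[|]]; [auto|auto|lia]. }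
    apply orb_true_iff in Q. destruct Q as [Q|Q];
      apply (stored_mono s1 r) in Q; try lia; congruence.
Qed.

(** * The reductions *)

Definition K (z : nat) : Prop := exists s, halts z s = true.

Lemma K_blocks z :
  K z <-> A (pack z 0) \/ A (pack z 1).
Proof.
  split.
  - intros [s Hs].
    (* This stage treats the block of [z] and is late enough for [z] to have halted. *)
    assert (L : s <= pack (pack z 0) s) by apply pack_ge.
    remember (pack (pack z 0) s) as t eqn:Et.
    assert (stored (state (S t)) (pack z 0) = true \/ stored (state (S t)) (pack z 1) = true).
    { change (state (S t)) with (next t (state t)). unfold next.
      rewrite Et, !pi1_pack, pi2_pack, <- Et. simpl. unfold encode_block.
      apply (halts_mono z s t L) in Hs. rewrite Hs.
      destruct (stored (state t) (pack z 0)) eqn:E0; [auto|].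
      destruct (stored (state t) (pack z 1)) eqn:E1; [auto|]. simpl.
      unfold stored at 1 2. rewrite pi1_pack, !setbit_true.
      unfold choice. destruct (_ <=? _); auto. }
    destruct H as [H|H]; [left|right]; exists (S t); unfold in_A; now rewrite H.
  - assert (Q : forall k, k < 2 -> A (pack z k) -> K z); [|intros [H|H]; [apply (Q 0)|apply (Q 1)]; auto].
    intros k Lk [s Hs]. unfold in_A in Hs. apply orb_true_iff in Hs.
    destruct Hs as [Hs|Hs].
    + induction s as [|s IH].
      * unfold stored in Hs. simpl in Hs. rewrite pi1_pack, Nat.bits_0 in Hs. discriminate.
      * apply stored_next in Hs. rewrite pi1_pack, pi2_pack in Hs.
        destruct Hs as [Hs|[Hs|(? & ? & ? & _)]]; [auto| |lia].
        exists s. tauto.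
    + rewrite pi2_pack in Hs. apply andb_true_iff in Hs. destruct Hs as [Hs _].
      apply Nat.leb_le in Hs. lia.
Qed.

Lemma A_blocks z : ~ (A (pack z 0) /\ A (pack z 1)).
Proof.
  intros [[s Hs] [t Ht]]. apply (in_A_mono s (s + t)) in Hs; [|lia].
  apply (in_A_mono t (s + t)) in Ht; [|lia].
  unfold in_A in Hs, Ht. rewrite pi2_pack, orb_false_r in Hs, Ht.
  apply (stored_block (s + t) z). auto.
Qed.

Lemma K_column z : K z <-> forall k, 2 <= k -> A (pack z k).
Proof.
  split.
  - intros [s Hs] k Hk. exists s. unfold in_A. rewrite pi1_pack, pi2_pack, Hs.
    now rewrite (proj2 (Nat.leb_le _ _) Hk), orb_true_r.
  - intros H. apply NNPP. intros No.
    (* The dumped part of the column is bounded, so the element with [k = 2 + N] can only have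
       entered because [z] halted. *)
    destruct (block_bound (S z)) as [N HN]; [intros; apply finitely_marked_all|].
    destruct (H (2 + N)) as [s Hs]; [lia|]. unfold in_A in Hs.
    apply orb_true_iff in Hs. destruct Hs as [Hs|Hs].
    + apply HN in Hs; rewrite ?pi1_pack, ?pi2_pack; try lia.
      pose proof (pack_ge z (2 + N)). lia.
    + apply andb_true_iff in Hs. destruct No. exists s. now rewrite pi1_pack in Hs.
Qed.

Lemma K_complete X : ce X -> exists f, rec f /\ forall x, X x <-> K (f x).
Proof.
  intros [e He].
  destruct (classic (exists c, encode c = e)) as [[c <-]|No].
  - exists (fun x => pack (encode c) x). split; [solve_rec|].
    intros x. rewrite He. split.
    + intros [v Hv]. apply halts_complete in Hv. destruct Hv as (s & Hs & _).
      exists s. exact Hs.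
    + intros [s Hs]. eapply halts_sound; eauto.
  (* If [e] numbers no program, [X] is empty, but the machine might halt on [e]; a program with
     empty domain is used instead. *)
  - destruct (semidecidable (fun _ _ => false)) as [c Hc]; [exact (rec_const 0)|].
    exists (fun x => pack (encode c) x). split; [solve_rec|].
    intros x. rewrite He. split.
    + intros (v & q & c' & E & _). destruct No; eauto.
    + intros [s Hs]. apply halts_sound, Hc in Hs. destruct Hs. discriminate.
Qed.

(** With [a = b] this is the index of a singleton, the form taken by the rows of the truth table. *)
Definition two (a b : nat) : nat := Nat.setbit (Nat.setbit 0 a) b.

Lemma in_D_two a b y : In y (D (two a b)) <-> y = a \/ y = b.
Proof.
  unfold two. rewrite in_D, !setbit_true, Nat.bits_0. intuition discriminate.
Qed.

Lemma length_D_two a b : length (D (two a b)) <= 2.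
Proof.
  change 2 with (length [a; b]). apply NoDup_incl_length; [apply NoDup_D|].
  intros y. rewrite in_D_two. simpl. intuition.
Qed.

Lemma rec_two f g : rec f -> rec g -> rec (fun x => two (f x) (g x)).
Proof. intros. unfold two. solve_rec. Qed.
Hint Resolve rec_two : rec.

Lemma Q_complete_A : complete le_Q A.
Proof.
  split; [exact ce_A|]. intros X HX. apply K_complete in HX. destruct HX as (f & Rf & Hf).
  (* The c.e. set assigned to [z] is the column of all [pack z k] with [2 <= k]. *)
  destruct (semidecidable (fun p _ => (pi1 p =? pi1 (pi2 p)) && (2 <=? pi2 (pi2 p))))
    as [c Hc]; [solve_rec|].
  destruct (smn c) as (g & Rg & Hg).
  exists (fun x => g (f x)). split; [apply rec_computable; solve_rec|].
  intros x. rewrite Hf, K_column. split.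
  - intros H y Hy. apply Hg, Hc in Hy. rewrite pi1_pack, pi2_pack in Hy.
    destruct Hy as [_ Hy]. apply andb_true_iff in Hy. destruct Hy as [E L].
    apply Nat.eqb_eq in E. apply Nat.leb_le in L.
    rewrite <- (pack_pi y), <- E. auto.
  - intros H k Hk. apply H, Hg, Hc. exists 0. rewrite !pi2_pack, !pi1_pack, Nat.eqb_refl.
    now apply Nat.leb_le in Hk.
Qed.

Lemma btt_complete_A : complete le_btt A.
Proof.
  split; [exact ce_A|]. intros X HX. apply K_complete in HX. destruct HX as (f & Rf & Hf).
  exists 2, (fun x => two (pack (f x) 0) (pack (f x) 1)),
    (* The satisfying rows are the two singletons; the row with both elements never occurs, by
       [A_blocks]. *)
    (fun x => two (two (pack (f x) 0) (pack (f x) 0)) (two (pack (f x) 1) (pack (f x) 1))).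
  split; [apply rec_computable; solve_rec|].
  split; [apply rec_computable; solve_rec|].
  intros x. split; [apply length_D_two|]. rewrite Hf, K_blocks.
  pose proof (A_blocks (f x)) as Excl. unfold tt_satisfied. split.
  - intros [H|H].
    + exists (two (pack (f x) 0) (pack (f x) 0)). rewrite in_D_two. split; [auto|].
      intros y. rewrite !in_D_two. intuition subst; auto. tauto.
    + exists (two (pack (f x) 1) (pack (f x) 1)). rewrite in_D_two. split; [auto|].
      intros y. rewrite !in_D_two. intuition subst; auto. tauto.
  - intros (r & Hr & H). rewrite in_D_two in Hr.
    destruct Hr as [-> | ->]; [left|right]; apply H; rewrite in_D_two; auto.
Qed.

Lemma bwtt_complete_A : complete le_bwtt A.
Proof.
  split; [exact ce_A|]. intros X HX. apply K_complete in HX. destruct HX as (f & Rf & Hf).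
  assert (R0 : rec (fun x => pack (f x) 0)) by solve_rec.
  assert (R1 : rec (fun x => pack (f x) 1)) by solve_rec.
  (* Both elements are always queried, and the answer is their disjunction. *)
  assert (Rs : rec (fun p => if pi1 p + pi2 p =? 0 then 0 else 1)) by solve_rec.
  destruct R0 as [c0 H0], R1 as [c1 H1], Rs as [c Hc].
  exists (encode (Comp c (Pair (Comp Oracle c0) (Comp Oracle c1)))),
    (fun x => two (pack (f x) 0) (pack (f x) 1)).
  split; [split|exists 2; intros; apply length_D_two].
  - apply rec_computable. solve_rec.
  - intros x. exists [pack (f x) 0; pack (f x) 1]. split.
    + set (a := pack (f x) 0). set (b := pack (f x) 1).
      assert (E0 : eval A (Comp Oracle c0) x (chi A a) [a])
        by exact (eval_Comp _ _ _ _ _ _ [] [_] (H0 A x) (eval_Oracle _ _)).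
      assert (E1 : eval A (Comp Oracle c1) x (chi A b) [b])
        by exact (eval_Comp _ _ _ _ _ _ [] [_] (H1 A x) (eval_Oracle _ _)).
      specialize (Hc A (pack (chi A a) (chi A b))).
      assert (E : (if pi1 (pack (chi A a) (chi A b)) + pi2 (pack (chi A a) (chi A b)) =? 0
                   then 0 else 1) = chi X x).
      { rewrite pi1_pack, pi2_pack. specialize (Hf x). rewrite K_blocks in Hf.
        fold a b in Hf. unfold chi.
        repeat destruct ClassicalEpsilon.excluded_middle_informative; simpl; tauto. }
      rewrite E in Hc. eexists. split; [reflexivity|].
      exact (eval_Comp _ _ _ _ _ _ [_; _] []
        (eval_Pair' _ _ _ _ _ _ [_] [_] E0 E1) Hc).
    + intros y. rewrite in_D_two. simpl. intuition.
Qed.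

(** * Failure of c-completeness *)

Lemma not_c_complete_A : ~ complete le_c A.
Proof.
  intros [_ HA]. destruct (HA B ce_B) as (f & [e He] & Hf).
  destruct (finitely_marked_all e) as [M HM].
  (* The least witness never marked exists because only finitely many are marked. *)
  assert (Hi : exists i, ~ B (pack e i) /\ forall j, j < i -> B (pack e j)).
  { apply NNPP. intros No.
    assert (Q : forall i, B (pack e i)).
    { intros i. induction i as [i IH] using lt_wf_ind. apply NNPP. intros N.
      apply No. eauto. }
    destruct (Q M) as [s Hs]. apply HM in Hs. lia. }
  destruct Hi as (i & Ni & Hi).
  assert (Hval : forall j s, conv e j s = true -> value e j s = f (pack e j)).
  { intros j s Hs. destruct (halts_complete _ _ _ (He (pack e j))) as (t & Ht & Hv).
    rewrite <- Hv. now apply out_stable. }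
  destruct (halts_complete _ _ _ (He (pack e i))) as (s0 & Hs0 & _).
  change (conv e i s0 = true) in Hs0.
  (* Each earlier witness is in [B], so the assumed reduction puts its finite set inside [A];
     finiteness gives one stage by which all its elements have entered. *)
  assert (Hfin : forall j, j < i -> exists s, finished (state s) s e j = true).
  { intros j Hj. pose proof (Hi j Hj) as [s Hs]. pose proof (Hi j Hj) as HB.
    rewrite Hf in HB. setoid_rewrite in_D in HB.
    destruct (common_bound (fun y s => Nat.testbit (f (pack e j)) y = true ->
      in_A (state s) s y = true) (f (pack e j))) as [t Ht].
    - intros y n m L H Hy. eapply in_A_mono; eauto.
    - intros y _. destruct (Nat.testbit (f (pack e j)) y) eqn:Ey.
      + destruct (HB y Ey) as [t Ht]. exists t. auto.
      + exists 0. discriminate.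
    - exists (s + t). apply andb_true_iff.
      assert (Hm : marked (state (s + t)) (pack e j) = true)
        by (eapply marked_mono; [|exact Hs]; lia).
      split; auto. apply marked_conv in Hm. rewrite (Hval _ _ Hm).
      apply subset_A_spec. intros y Hy.
      apply (in_A_mono t); [lia|]. apply Ht; auto. apply testbit_lt, Hy. }
  destruct (common_bound (fun j s => finished (state s) s e j = true) i) as [s1 Hs1]; auto.
  { intros j n m L. now apply finished_mono. }
  (* A stage attacking [e], late enough for F(e,i) to be known and for all earlier witnesses to be
     finished. *)
  remember (pack (pack e 1) (s0 + s1)) as s eqn:Es.
  assert (Ls : s0 + s1 <= s) by (subst s; apply pack_ge).
  assert (Hc : conv e i s = true) by (eapply conv_mono; [|exact Hs0]; lia).
  assert (Nm : forall t, marked (state t) (pack e i) = false).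
  { intros t. destruct (marked (state t) (pack e i)) eqn:E; auto.
    destruct Ni. exists t. exact E. }
  assert (Ec : current (state s) s e = i).
  { apply current_spec. split.
    - unfold finished. now rewrite Nm.
    - intros j Hj. apply (finished_mono s1 s); auto. lia. }
  (* The attack does not mark [pack e i], so dumping must have brought F(e,i) into [A]; the
     reduction then puts the witness into [B], a contradiction. *)
  assert (Sub : subset_A (state (S s)) (S s) (f (pack e i)) = true).
  { specialize (Nm (S s)) as Nm'. revert Nm'.
    change (state (S s)) with (next s (state s)). unfold next.
    rewrite Es, !pi1_pack, pi2_pack, <- Es, Ec. simpl. unfold attack.
    rewrite Hc, Nm. simpl. rewrite Hval by auto.
    destruct (subset_A _ _ _) eqn:E; auto.
    unfold marked. rewrite pi2_pack, <- not_true_iff_false, setbit_true. tauto. }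
  apply Ni, Hf. intros y Hy. apply in_D in Hy. exists (S s).
  rewrite subset_A_spec in Sub. auto.
Qed.

Theorem corollary2p13 :
  (exists A : nat -> Prop,
     ce A /\ complete le_Q A /\ complete le_bwtt A /\ ~ complete le_c A) /\
  (exists A : nat -> Prop,
     ce A /\ complete le_Q A /\ complete le_btt A /\ ~ complete le_c A).
Proof.
  split; exists A; auto using ce_A, Q_complete_A, bwtt_complete_A, btt_complete_A,
    not_c_complete_A.
Qed.
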